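(* For $\alpha > 0$ with $\alpha \neq 2$ and any intensity $u>0$, the scale-homogeneous Poisson stick soup (HPS) with parameters $u,\alpha$ satisfies $\mathbb{P}(\mathcal{E} \text{ percolates}) = 1$ and $\mathbb{P}(\mathcal{V} \text{ percolates}) = 0$.
   Context: Let $S := \mathbb{R}^2\times(0,\infty)\times(-\pi/2,\pi/2]$. A point $s=(z,R,V)\in S$ represents the closed segment (stick) $E_0(s)$ centered at $z$, of length $2R$ and direction (angle) $V$. For $\alpha,u>0$, the HPS $\xi$ is the Poisson point process on $S$ with intensity $u\mu_\alpha$, where $\mu_\alpha=\mathrm{d}z\otimes\alpha R^{-(1+\alpha)}\,\mathrm{d}R\otimes\frac1\pi\,\mathrm{d}V$. The covered set is $\mathcal{E}=\bigcup_{s\in\xi}E_0(s)$ and the vacant set is $\mathcal{V}=\mathbb{R}^2\setminus\mathcal{E}$. A set percolates if it has an unbounded connected component. *)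

(* Defs.v *)
From HB Require Import structures.
From mathcomp Require Import all_boot all_order all_algebra.
From mathcomp Require Import all_classical all_reals all_analysis measurable_realfun.

Set Implicit Arguments.
Unset Strict Implicit.
Unset Printing Implicit Defensive.

Import Order.TTheory GRing.Theory Num.Theory.
Import numFieldNormedType.Exports.

Local Open Scope classical_set_scope.
Local Open Scope ring_scope.

Definition density_measure {R : realType} (f : measurableTypeR R -> R)
    (mf : measurable_fun setT f) (f0 : forall x, 0 <= f x)
    (A : set (measurableTypeR R)) : \bar R :=
  (\int[lebesgue_measure]_(x in A) (f x)%:E)%E.

Section density_measure.
Local Open Scope ereal_scope.
Context {R : realType} (f : measurableTypeR R -> R).
Variables (mf : measurable_fun setT f) (f0 : forall x, (0 <= f x)%R).

Local Notation nu := (density_measure mf f0).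

Let nu0 : nu set0 = 0.
Proof. by rewrite /density_measure integral_set0. Qed.

Let nu_ge0 A : 0 <= nu A.
Proof. by apply: integral_ge0 => x _; rewrite lee_fin. Qed.

Let nu_sigma_additive : semi_sigma_additive nu.
Proof.
move=> F mF tF mUF; rewrite /density_measure.
rewrite ge0_integral_bigcup//.
- apply: cvg_toP; last by [].
  by apply: is_cvg_ereal_nneg_natsum => k _; exact: nu_ge0.
- apply/measurable_EFinP; exact: measurable_funS mf.
- by move=> x _; rewrite lee_fin.
Qed.

HB.instance Definition _ := isMeasure.Build _ _ _ nu
  nu0 nu_ge0 nu_sigma_additive.

Let nu_sigma_finite : sigma_finite setT nu.
Proof.
pose F (n : nat) : set (measurableTypeR R) :=
  `[(- n%:R)%R, n%:R%R] `&` (f @^-1` `]-oo, n%:R%R]).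
have mF n : measurable (F n).
  apply: measurableI; first exact: measurable_itv.
  by rewrite -[X in measurable X]setTI; apply: mf.
exists F.
  apply/seteqP; split => // x _.
  exists (Num.truncn (Order.max `|x| (f x))%R).+1 => //=.
  have := truncnS_gt (Order.max `|x| (f x))%R.
  rewrite gt_max => /andP[/ltW h1 /ltW h2].
  by split; rewrite /= in_itv //= -ler_norml.
move=> n; split => //.
apply: (@le_lt_trans _ _ (\int[lebesgue_measure]_(x in F n) (n%:R%R)%:E)).
  apply: ge0_le_integral => //.
  - by move=> x _; rewrite lee_fin.
  - by apply/measurable_EFinP; exact: measurable_funS mf.
  - by move=> x [_]; rewrite /= in_itv lee_fin.
rewrite integral_cst; last exact: mF.
rewrite lte_mul_pinfty//.
apply: (@le_lt_trans _ _ (lebesgue_measure `[(- n%:R)%R, n%:R%R]%classic)).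
  apply: le_measure; rewrite ?inE; [exact: mF|exact: measurable_itv|].
  exact: subIsetl.
by rewrite lebesgue_measure_itv/=; case: ifP => // _; rewrite -EFinB ltry.
Qed.

HB.instance Definition _ := Measure_isSigmaFinite.Build _ _ _ nu
  nu_sigma_finite.

End density_measure.

(* The stick [(z1, z2, r, v)] has centre [(z1, z2)], half-length [r] and angle
   [v]; [measurableTypeR R] is the copy of [R] whose Borel
   sigma-algebra carries [lebesgue_measure]. *)
Notation stickT R := (measurableTypeR R * measurableTypeR R
  * measurableTypeR R * measurableTypeR R)%type (only parsing).

Section stick_measure.
Context {R : realType}.

Definition radius_density (alpha : {posnum R}) (r : measurableTypeR R) : R :=
  alpha%:num * r `^ (- (1 + alpha%:num)) * \1_`]0, +oo[ r.

Lemma measurable_radius_density alpha :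
  measurable_fun setT (radius_density alpha).
Proof.
apply: measurable_funM; last exact: measurable_indic.
apply: measurable_funM; first exact: measurable_cst.
exact: measurable_powR.
Qed.

Lemma radius_density_ge0 alpha r : 0 <= radius_density alpha r.
Proof. by rewrite /radius_density !mulr_ge0// powR_ge0. Qed.

Definition angle_density (v : measurableTypeR R) : R :=
  pi^-1 * \1_`](- (pi / 2)), (pi / 2)] v.

Lemma measurable_angle_density : measurable_fun setT angle_density.
Proof.
apply: measurable_funM; last exact: measurable_indic.
exact: measurable_cst.
Qed.

Lemma angle_density_ge0 v : 0 <= angle_density v.
Proof. by rewrite /angle_density mulr_ge0// invr_ge0 pi_ge0. Qed.

Definition stick_measure (alpha : {posnum R}) :
    {measure set (stickT R) -> \bar R} :=
  (((lebesgue_measure \x lebesgue_measure)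
     \x density_measure (measurable_radius_density alpha)
                        (radius_density_ge0 alpha))
     \x density_measure measurable_angle_density angle_density_ge0)%E.

Definition stick_space : set (stickT R) :=
  [set s | 0 < s.1.2 /\ s.2 \in `](- (pi / 2)), (pi / 2)]].

Definition stick (s : stickT R) : set (R * R) :=
  [set (s.1.1.1 + t * cos s.2, s.1.1.2 + t * sin s.2)
    | t in `[- s.1.2, s.1.2]].

Definition covered_set (X : set (stickT R)) : set (R * R) :=
  \bigcup_(s in X) stick s.

Definition vacant_set (X : set (stickT R)) : set (R * R) :=
  ~` covered_set X.

Definition percolates (A : set (R * R)) : Prop :=
  exists2 x, A x & ~ bounded_set (connected_component A x).

End stick_measure.

Section poisson_process.
Local Open Scope ereal_scope.
Context {R : realType}.

Definition independent_family d (Omega : measurableType d)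
    (P : probability Omega R) (n : nat) (N : 'I_n -> Omega -> \bar R) : Prop :=
  forall B : 'I_n -> set (\bar R), (forall i, measurable (B i)) ->
    P (\bigcap_(i in setT) (N i @^-1` B i)) = \prod_(i < n) P (N i @^-1` B i).

Definition point_count (T : choiceType) (X A : set T) : \bar R :=
  counting (X `&` A).

(* The configuration is a random countable set: this loses nothing against a
   random counting measure when [mu] is sigma-finite and diffuse, since the
   process is then almost surely simple.  The Poisson weights are written out
   because [poisson_pmf] does not give the Dirac mass at 0 for the rate 0. *)
Record poisson_point_process dO (Omega : measurableType dO)
    (P : probability Omega R) d (T : measurableType d) (S : set T)
    (mu : {measure set T -> \bar R}) (X : Omega -> set T) : Prop := {
  ppp_sub : forall w, X w `<=` S ;
  ppp_countable : forall w, countable (X w) ;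
  ppp_measurable : forall A, measurable A ->
    measurable_fun setT (fun w => point_count (X w) A) ;
  ppp_poisson : forall A, measurable A -> mu A < +oo -> forall k : nat,
    P [set w | point_count (X w) A = k%:R%:E] =
      (expR (- fine (mu A)) * fine (mu A) ^+ k / k`!%:R)%:E ;
  ppp_infinite : forall A, measurable A -> mu A = +oo ->
    P [set w | point_count (X w) A = +oo] = 1 ;
  ppp_independent : forall (n : nat) (A : 'I_n -> set T),
    (forall i, measurable (A i)) -> trivIset setT A ->
    independent_family P (fun i w => point_count (X w) (A i))
}.

Definition stick_soup dO (Omega : measurableType dO) (P : probability Omega R)
    (u alpha : {posnum R}) (xi : Omega -> set (stickT R)) : Prop :=
  poisson_point_process P stick_space
    (mscale (u%:num%:nng)%R (stick_measure alpha)) xi.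

End poisson_process.

(* Main.v *)
(* Scaling lengths by L multiplies the intensity of the soup by L^(2 - alpha),
   so since alpha <> 2 there are scales rho^n, with rho = 2 or rho = 1/2
   according to the sign of 2 - alpha, along which the soup becomes
   exponentially dense.  At scale L = rho^n consider the points of the grid
   L * Z^2 in a box of size L * 4^n, much larger than both 1 and L.  By
   Borel-Cantelli, for all large n every grid point has near it a nearly
   horizontal and a nearly vertical stick of half-length at least 2 L.  Four
   such sticks around a grid point form a frame that no connected set avoiding
   them can leave, so vacant components are bounded.  The sticks of one scale
   form a connected subset of the covered set, which is too large to fit inside
   a frame of the next scale and hence hits it: all large scales lie in one
   unbounded component. *)
Require Import Defs.
From HB Require Import structures.
From mathcomp Require Import all_boot all_order all_algebra.
From mathcomp Require Import all_classical all_reals all_analysis.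
From mathcomp Require Import measurable_realfun ring lra zify.

Set Implicit Arguments.
Unset Strict Implicit.
Unset Printing Implicit Defensive.

Import Order.TTheory GRing.Theory Num.Theory.
Import numFieldNormedType.Exports.

Local Open Scope classical_set_scope.
Local Open Scope ring_scope.

Section sticks.
Context {R : realType}.
Implicit Types (s t : stickT R) (p q a b : R * R) (L v : R).

(** * Geometry of sticks *)

(** Angles near 0, described by bounds on [cos] and [sin] so that later estimates reduce to linear
    or quadratic arithmetic; [steep] is the analogue near [pi / 2]. *)
Definition flat v := [/\ 9/10 <= cos v, - (1/10) <= sin v & sin v <= 1/10].

Definition steep v := [/\ 9/10 <= sin v, - (1/10) <= cos v & cos v <= 1/10].

Lemma flat_steep v : flat v -> steep (pi / 2 - v).
Proof.
by rewrite /flat /steep sinB cosB sin_pihalf cos_pihalf => -[*];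
  split; lra.
Qed.

(** Continuity of [cos] and [sin] at 0. Only nonnegative angles are kept, so that the mirror image
    [[pi / 2 - dl, pi / 2]] stays in the half-open range of angles. *)
Lemma flat_near0 :
  exists2 dl : R, 0 < dl < pi / 2 & forall v, 0 <= v <= dl -> flat v.
Proof.
have [e e0 He] : exists2 e : R, 0 < e & forall v, `|v| < e -> flat v.
  have: \forall v \near (0 : R), flat v.
    have cc : (cos v @[v --> (0:R)] --> (1 : R)).
      by rewrite -[X in _ --> X]cos0; exact: continuous_cos.
    have cs : (sin v @[v --> (0:R)] --> (0 : R)).
      by rewrite -[X in _ --> X]sin0; exact: continuous_sin.
    near=> v.
    have h1 : 9/10 <= cos v.
      by near: v; apply: (cvgr_ge _ cc); lra.
    have h2 : - (1/10) <= sin v by near: v; apply: (cvgr_ge _ cs); lra.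
    have h3 : sin v <= 1/10 by near: v; apply: (cvgr_le _ cs); lra.
    by split.
  move/nbhs_ballP => [e /= e0 He]; exists e => // v ve.
  by apply: He; rewrite /ball /= sub0r normrN.
have pi0 := pi_gt0 R.
exists (Num.min (e / 2) (pi / 4)) => [|v].
  rewrite lt_min gt_min; apply/andP; split; first by apply/andP; split; lra.
  by apply/orP; right; lra.
by rewrite le_min => /and3P[v0 ve _]; apply: He; rewrite ger0_norm//; lra.
Unshelve. all: by end_near.
Qed.

Definition near_center L a s :=
  [/\ `|s.1.1.1 - a.1| <= L / 10, `|s.1.1.2 - a.2| <= L / 10 & 2 * L <= s.1.2].

Definition hstick L a s := near_center L a s /\ flat s.2.
Definition vstick L a s := near_center L a s /\ steep s.2.

(* Signed distance from [p] to the line carrying the stick [s]. *)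
Definition offset s p : R :=
  (p.2 - s.1.1.2) * cos s.2 - (p.1 - s.1.1.1) * sin s.2.

Lemma stick_center s : 0 <= s.1.2 -> stick s s.1.1.
Proof.
move=> s0; exists 0; first by rewrite /= in_itv /= oppr_le0 s0.
by rewrite !mul0r !addr0 -surjective_pairing.
Qed.

(** A point of the carrying line has parameter [(x - z1) / cos v], which is at most
    [(9/5 * L) / (9/10) = 2 * L] in absolute value and so does not exceed the half-length. *)
Lemma flat_stick L s p : flat s.2 -> 2 * L <= s.1.2 ->
  `|p.1 - s.1.1.1| <= 9/5 * L -> offset s p = 0 -> stick s p.
Proof.
case: s => [[[z1 z2] r] v]; case: p => x y; rewrite /flat /offset /stick /=.
move=> [c s1 s2] Lr; rewrite ler_norml => /andP[h1 h2] /eqP.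
rewrite subr_eq0 => /eqP f0.
have c0 : cos v != 0 by rewrite gt_eqF//; lra.
exists ((x - z1) / cos v); last first.
  congr pair; first by rewrite divfK//; ring.
  by rewrite mulrAC -f0 mulfK//; ring.
rewrite /= in_itv /= ler_pdivlMr ?ler_pdivrMr; try lra; nra.
Qed.

Lemma steep_stick L s p : steep s.2 -> 2 * L <= s.1.2 ->
  `|p.2 - s.1.1.2| <= 9/5 * L -> offset s p = 0 -> stick s p.
Proof.
case: s => [[[z1 z2] r] v]; case: p => x y; rewrite /steep /offset /stick /=.
move=> [c s1 s2] Lr; rewrite ler_norml => /andP[h1 h2] /eqP.
rewrite subr_eq0 => /eqP f0.
have c0 : sin v != 0 by rewrite gt_eqF//; lra.
exists ((y - z2) / sin v); last first.
  congr pair; last by rewrite divfK//; ring.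
  by rewrite mulrAC f0 mulfK//; ring.
rewrite /= in_itv /= ler_pdivlMr ?ler_pdivrMr; try lra; nra.
Qed.

Lemma mulr_bounds (x y A B : R) : - A <= x -> x <= A -> - B <= y -> y <= B ->
  - (A * B) <= x * y /\ x * y <= A * B.
Proof.
move=> x1 x2 y1 y2; apply/andP; rewrite -ler_norml normrM.
by apply: ler_pM => //; rewrite ler_norml; apply/andP; split.
Qed.

(** Cramer's rule gives the parameters of the crossing point on the two lines. The centres differ by
    at most [L + 2 * (L / 10)] in each coordinate, so the numerators are at most [33/25 * L], below
    [8/5 * L <= r * D]. *)
Lemma sticks_cross L a b s t : 0 <= L -> hstick L a s -> vstick L b t ->
  `|a.1 - b.1| <= L -> `|a.2 - b.2| <= L -> stick s `&` stick t !=set0.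
Proof.
case: s t => [[[x1 y1] r1] v] [[[x2 y2] r2] w]; case: a b => a1 a2 [b1 b2].
rewrite /hstick /vstick /near_center /= !ler_norml => L0.
move=> [[/andP[? ?] /andP[? ?] ?] [cv sv1 sv2]].
move=> [[/andP[? ?] /andP[? ?] ?] [sw cw1 cw2]].
move=> /andP[? ?] /andP[? ?].
(* [D] is [sin (w - v)], the determinant of the linear system; it is at least [81/100 - 1/100]. *)
set D := cos v * sin w - sin v * cos w.
have D8 : 8/10 <= D.
  have : 9/10 * (9/10) <= cos v * sin w by apply: ler_pM; lra.
  by have [] := mulr_bounds sv1 sv2 cw1 cw2; rewrite /D; lra.
have D0 : D != 0 by rewrite gt_eqF//; lra.
pose dx := x2 - x1; pose dy := y2 - y1.
have [dx1 dx2] : - (6/5 * L) <= dx /\ dx <= 6/5 * L by rewrite /dx; lra.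
have [dy1 dy2] : - (6/5 * L) <= dy /\ dy <= 6/5 * L by rewrite /dy; lra.
have cv' := cos_le1 v; have sw' := sin_le1 w.
have rD (r : R) : 2 * L <= r -> 8/5 * L <= r * D.
  by move=> Lr; have : 2 * L * (8/10) <= r * D; [apply: ler_pM; lra|lra].
have [rD1 rD2] : 8/5 * L <= r1 * D /\ 8/5 * L <= r2 * D by split; exact: rD.
have [cv1 sw1] : - 1 <= cos v /\ - 1 <= sin w by split; lra.
have [dxw1 dxw2] := mulr_bounds dx1 dx2 sw1 sw'.
have [dyw1 dyw2] := mulr_bounds dy1 dy2 cw1 cw2.
have [dxv1 dxv2] := mulr_bounds dx1 dx2 sv1 sv2.
have [dyv1 dyv2] := mulr_bounds dy1 dy2 cv1 cv'.
pose m := (dx * sin w - dy * cos w) / D.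
pose k := (dx * sin v - dy * cos v) / D.
exists (x1 + m * cos v, y1 + m * sin v); split.
  exists m => //; rewrite /m /= in_itv /= ler_pdivlMr ?ler_pdivrMr; lra.
exists k; first by rewrite /k /= in_itv /= ler_pdivlMr ?ler_pdivrMr; lra.
by congr pair; rewrite /= /m /k /dx /dy /D; field; rewrite -/D.
Qed.

Lemma stick_connected s : connected (stick s).
Proof.
apply: (@connected_continuous_connected _ _ _ (fun t : R =>
  (s.1.1.1 + t * cos s.2, s.1.1.2 + t * sin s.2))).
  exact: segment_connected.
apply: continuous_subspaceT => t; rewrite /continuous_at.
have ct (a b : R) : x * b @[x --> t] --> t * b.
  by apply: cvgM; [exact: cvg_id|exact: cvg_cst].
have cD (c b : R) : c + x * b @[x --> t] --> c + t * b.
  by apply: cvgD; [exact: cvg_cst|exact: ct].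
exact: (cvg_pair (cD s.1.1.1 (cos s.2)) (cD s.1.1.2 (sin s.2))).
Qed.

Lemma offset_continuous s : continuous (offset s).
Proof.
move=> p; by apply: cvgB; apply: cvgM; try exact: cvg_cst; apply: cvgB;
  first [exact: cvg_cst|exact: cvg_fst|exact: cvg_snd].
Qed.

(** On [C] the open condition [f x < 0] and the closed condition [f x <= 0] coincide because [f]
    does not vanish there, so they cut out a clopen part of [C]. *)
Lemma connected_negative (T : topologicalType) (C : set T) (f : T -> R) :
  continuous f -> connected C -> (forall x, C x -> f x != 0) ->
  C `&` [set x | f x < 0] !=set0 -> C `<=` [set x | f x < 0].
Proof.
move=> cf cC f0 Cf.
suff <- : C `&` [set x | f x < 0] = C by move=> x [].
apply: cC => //.
  exists [set x | f x < 0] => //.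
  by apply: (@open_comp _ _ f [set y | y < 0]); [move=> x _; exact: cf|exact: open_lt].
exists [set x | f x <= 0].
  by apply: (@closed_comp _ _ f [set y | y <= 0]); [move=> x _; exact: cf|exact: closed_le].
apply/seteqP; split=> x [Cx /= fx]; split => //; first exact: ltW.
by rewrite /= lt_neqAle f0.
Qed.

Definition inbox L a p := `|p.1 - a.1| <= L /\ `|p.2 - a.2| <= L.

(** The vertical gap to the centre is at least [2/5 * L] and contributes at least [9/25 * L] to the
    offset. The horizontal gap is at most [8/5 * L] and contributes at most [4/25 * L], so it cannot
    change the sign. *)
Lemma hstick_offset L a s p : 0 < L -> hstick L a s -> `|p.1 - a.1| <= 3/2 * L ->
  [/\ a.2 + L / 2 <= p.2 -> 0 < offset s p, p.2 <= a.2 - L / 2 -> offset s p < 0 &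
      offset s p = 0 -> stick s p].
Proof.
move=> L0 [[s1 s2 sL] sf] pL; split; last first.
  move=> p0; apply: (flat_stick sf sL) => //.
  by move: s1 pL; rewrite !ler_norml => /andP[? ?] /andP[? ?]; apply/andP; split; lra.
all: move: sf s1 s2 pL; rewrite /flat /offset !ler_norml.
all: move=> [c9 sa sb] /andP[? ?] /andP[? ?] /andP[? ?] ?.
all: have c1 := cos_le1 s.2.
all: have [] := @mulr_bounds (p.1 - s.1.1.1) (sin s.2) (8/5 * L) (1/10)
  _ _ sa sb; [lra..|].
  by have : 2/5 * L * (9/10) <= (s.1.1.2 - p.2) * cos s.2;
    [apply: ler_pM; lra|move=> *; lra].
by have : 2/5 * L * (9/10) <= (p.2 - s.1.1.2) * cos s.2;
    [apply: ler_pM; lra|move=> *; lra].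
Qed.

(** Same estimate with the coordinates exchanged; the sign flips, the offset being negative to the
    right of a steep stick. *)
Lemma vstick_offset L a s p : 0 < L -> vstick L a s -> `|p.2 - a.2| <= 3/2 * L ->
  [/\ a.1 + L / 2 <= p.1 -> offset s p < 0, p.1 <= a.1 - L / 2 -> 0 < offset s p &
      offset s p = 0 -> stick s p].
Proof.
move=> L0 [[s1 s2 sL] sf] pL; split; last first.
  move=> p0; apply: (steep_stick sf sL) => //.
  by move: s2 pL; rewrite !ler_norml => /andP[? ?] /andP[? ?]; apply/andP; split; lra.
all: move: sf s1 s2 pL; rewrite /steep /offset !ler_norml.
all: move=> [c9 sa sb] /andP[? ?] /andP[? ?] /andP[? ?] ?.
all: have c1 := sin_le1 s.2.
all: have [] := @mulr_bounds (p.2 - s.1.1.2) (cos s.2) (8/5 * L) (1/10)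
  _ _ sa sb; [lra..|].
  by have : 2/5 * L * (9/10) <= (s.1.1.1 - p.1) * sin s.2;
    [apply: ler_pM; lra|move=> *; lra].
by have : 2/5 * L * (9/10) <= (p.1 - s.1.1.1) * sin s.2;
    [apply: ler_pM; lra|move=> *; lra].
Qed.

(** The enclosed region is written as the negativity set of one continuous function, to which
    [connected_negative] applies. *)
Lemma frame_traps L a sT sB sR sL (C : set (R * R)) p : 0 < L ->
  hstick L (a.1, a.2 + L) sT -> hstick L (a.1, a.2 - L) sB ->
  vstick L (a.1 + L, a.2) sR -> vstick L (a.1 - L, a.2) sL ->
  connected C ->
  (forall q, C q -> [/\ ~ stick sT q, ~ stick sB q, ~ stick sR q & ~ stick sL q]) ->
  C p -> inbox (L / 2) a p -> C `<=` inbox (3/2 * L) a.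
Proof.
move=> L0 hT hB vR vL cC Cs Cp [].
rewrite !ler_norml => /andP[p1 p2] /andP[p3 p4].
(* Negative exactly at the points of the open box of radius [3/2 * L] lying on the inner side of the
   four carrying lines. The box terms matter because the lines extend beyond the sticks. *)
pose f : R * R -> R :=
  ((fun q => `|q.1 - a.1| - 3/2 * L) \max (fun q => `|q.2 - a.2| - 3/2 * L)) \max
  ((offset sT \max (fun q => - offset sB q)) \max
   ((fun q => - offset sR q) \max offset sL)).
have cf : continuous f.
  have c1 : continuous (fun q : R * R => `|q.1 - a.1| - 3/2 * L).
    move=> q; apply: cvgB; last exact: cvg_cst.
    by apply: cvg_norm; apply: cvgB; [exact: cvg_fst|exact: cvg_cst].
  have c2 : continuous (fun q : R * R => `|q.2 - a.2| - 3/2 * L).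
    move=> q; apply: cvgB; last exact: cvg_cst.
    by apply: cvg_norm; apply: cvgB; [exact: cvg_snd|exact: cvg_cst].
  have cN s : continuous (fun q => - offset s q).
    by move=> q; apply: cvgN; exact: offset_continuous.
  move=> q; apply: continuous_max; apply: continuous_max;
    [exact: c1|exact: c2|apply: continuous_max..];
    first [exact: cN|exact: offset_continuous].
have fin q : f q <= 0 -> inbox (3/2 * L) a q.
  by rewrite /f /= !ge_max => /andP[/andP[q1 q2] _]; split; lra.
have fE q : inbox (3/2 * L) a q ->
  [/\ _, _, _ & _] := fun iq => And4 (@hstick_offset L (a.1, a.2 + L) sT q L0 hT iq.1)
      (@hstick_offset L (a.1, a.2 - L) sB q L0 hB iq.1)
      (@vstick_offset L (a.1 + L, a.2) sR q L0 vR iq.2)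
      (@vstick_offset L (a.1 - L, a.2) sL q L0 vL iq.2).
suff sub : C `<=` [set q | f q < 0] by move=> q /sub /ltW /fin.
apply: connected_negative => //.
  move=> q Cq; apply/eqP => fq0.
  have iq : inbox (3/2 * L) a q by apply: fin; rewrite fq0.
  have [sT0 sB0 sR0 sL0] := Cs _ Cq.
  have [/= [T1 T2 T3] [B1 B2 B3] [R1 R2 R3] [L1 L2 L3]] := fE _ iq.
  have := lexx (f q); rewrite {2}fq0 {1}/f /= !ge_max.
  move=> /and3P[/andP[_ _] /andP[fT fB] /andP[fR fL]].
  have {}fT : offset sT q < 0 by rewrite lt_neqAle fT andbT; apply/eqP => /T3.
  have {}fB : 0 < offset sB q.
    by rewrite lt_neqAle eq_sym -oppr_le0 fB andbT; apply/eqP => /B3.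
  have {}fR : 0 < offset sR q.
    by rewrite lt_neqAle eq_sym -oppr_le0 fR andbT; apply/eqP => /R3.
  have {}fL : offset sL q < 0 by rewrite lt_neqAle fL andbT; apply/eqP => /L3.
  (* Being strictly on the inner side of each stick forces [q] strictly inside the box, so all six
     terms are negative, against [f q = 0]. *)
  have q1 : q.1 < a.1 + L + L / 2.
    by rewrite ltNge; apply/negP => /R1; lra.
  have q2 : a.1 - L - L / 2 < q.1.
    by rewrite ltNge; apply/negP => /L2; lra.
  have q3 : q.2 < a.2 + L + L / 2.
    by rewrite ltNge; apply/negP => /T1; lra.
  have q4 : a.2 - L - L / 2 < q.2.
    by rewrite ltNge; apply/negP => /B2; lra.
  suff : f q < 0 by rewrite fq0 ltxx.
  rewrite /f /= !gt_max fT fL !oppr_lt0 fB fR !andbT !subr_lt0 !ltr_norml.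
  by apply/andP; split; apply/andP; split; lra.
exists p; split=> //=.
have ip : inbox (3/2 * L) a p.
  by rewrite /inbox !ler_norml; split; apply/andP; split; lra.
have [/= [T1 T2 T3] [B1 B2 B3] [R1 R2 R3] [L1 L2 L3]] := fE _ ip.
rewrite /f /= !gt_max !oppr_lt0 T2 ?B1 ?R2 ?L1 ?andbT; try lra.
by rewrite !subr_lt0 !ltr_norml; apply/andP; split; apply/andP; split; lra.
Qed.

(** * Stick boxes are rarely empty *)

Lemma density_measure_itv_bounds (f : measurableTypeR R -> R)
    (mf : measurable_fun setT f) (f0 : forall x, 0 <= f x) (a b m M : R) :
  a <= b -> (forall x, a <= x <= b -> m <= f x <= M) -> 0 <= m ->
  ((m * (b - a))%:E <= density_measure mf f0 `[a, b] <= (M * (b - a))%:E)%E.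
Proof.
move=> ab fmM m0.
have lab : lebesgue_measure (`[a, b]%classic : set (measurableTypeR R)) = (b - a)%:E.
  rewrite lebesgue_measure_itv /= lte_fin; case: ltP => // ba.
  have -> : b = a by apply/eqP; rewrite eq_le ba ab.
  by rewrite subrr.
have E (c : R) : ((c * (b - a))%:E =
    \int[@lebesgue_measure R]_(x in `[a, b]%classic) c%:E)%E.
  by rewrite integral_cst// EFinM -lab.
have M0 : 0 <= M.
  have := fmM a; rewrite lexx ab => /(_ isT).
  by move=> /andP[/(le_trans m0) /le_trans]; exact.
rewrite !E /density_measure; apply/andP; split; apply: ge0_le_integral => //.
all: try by apply/measurable_EFinP; exact: measurable_funS mf.
- by move=> x; rewrite /= in_itv /= lee_fin => /fmM /andP[].
- by move=> x _; rewrite lee_fin.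
- by move=> x; rewrite /= in_itv /= lee_fin => /fmM /andP[].
Qed.

(** The density decreases, so it is bounded below by its value at [3 * L], and the interval has
    length [L]. The bound by the value at [2 * L] gives finiteness. *)
Lemma radius_measure_bounds (alpha : {posnum R}) (L : R) : 0 < L ->
  exists2 m : R, density_measure (measurable_radius_density alpha)
     (radius_density_ge0 alpha) `[2 * L, 3 * L] = m%:E &
  alpha%:num * 3 `^ (- (1 + alpha%:num)) * L `^ (- alpha%:num) <= m.
Proof.
move=> L0; set e := 1 + alpha%:num.
have e0 : 0 < e by rewrite addr_gt0.
have /andP[h1 h2] : ((alpha%:num * (3 * L) `^ (- e) * (3 * L - 2 * L))%:E <=
  density_measure (measurable_radius_density alpha) (radius_density_ge0 alpha)
    `[(2 * L)%R, (3 * L)%R] <= (alpha%:num * (2 * L) `^ (- e) * (3 * L - 2 * L))%:E)%E.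
  apply: density_measure_itv_bounds => [|x /andP[x2 x3]|]; first lra.
    rewrite /radius_density indicE mem_set ?mulr1; last first.
      by rewrite /= in_itv /= andbT; lra.
    by rewrite !ler_pM2l// !powRN !lef_pV2 ?posrE ?powR_gt0 ?ge0_ler_powR ?nnegrE//; lra.
  by rewrite mulr_ge0// powR_ge0.
exists (fine (density_measure (measurable_radius_density alpha)
    (radius_density_ge0 alpha) `[2 * L, 3 * L])).
  by rewrite fineK// fin_numE; apply/andP; split; apply/eqP => E; rewrite E in h1 h2.
rewrite -lee_fin fineK; last first.
  by rewrite fin_numE; apply/andP; split; apply/eqP => E; rewrite E in h1 h2.
apply: le_trans h1; rewrite lee_fin powRM; [|lra..].
rewrite -!mulrA !ler_pM2l ?powR_gt0//.
have -> : 3 * L - 2 * L = L by ring.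
rewrite -{3}(powRr1 (ltW L0)) -powRD; last by rewrite (gt_eqF L0) implybT.
by rewrite /e opprD addrAC addNr add0r.
Qed.

Lemma angle_measure_itv (a b : R) : - (pi / 2) < a -> a < b -> b <= pi / 2 ->
  density_measure measurable_angle_density angle_density_ge0 `[a, b] =
  (pi^-1 * (b - a))%:E.
Proof.
move=> a0 ab bpi; apply/eqP; rewrite eq_le andbC.
apply: density_measure_itv_bounds => [|x /andP[ax xb]|].
- exact: ltW.
- rewrite /angle_density indicE mem_set ?mulr1 ?lexx//= in_itv /=.
  by rewrite (lt_le_trans a0)// (le_trans xb).
- by rewrite invr_ge0 pi_ge0.
Qed.

Definition stick_box (L : R) (a : R * R) (lo hi : R) : set (stickT R) :=
  ((`[a.1 - L / 10, a.1 + L / 10] `*` `[a.2 - L / 10, a.2 + L / 10])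
     `*` `[2 * L, 3 * L]) `*` `[lo, hi].

Lemma measurable_stick_box L a lo hi : measurable (stick_box L a lo hi).
Proof. by do 3!apply: measurableX => //. Qed.

(** The measure factors over the product: the two centre intervals give [(L / 5) ^ 2], the radius
    interval a multiple of [L ^ (- alpha)], and the angle interval a constant. *)
Lemma stick_box_measure (alpha : {posnum R}) (lo hi : R) :
  - (pi / 2) < lo -> lo < hi -> hi <= pi / 2 ->
  exists2 c : R, 0 < c & forall L a, 0 < L ->
  exists2 m : R, stick_measure alpha (stick_box L a lo hi) = m%:E &
    c * L `^ (2 - alpha%:num) <= m.
Proof.
move=> h1 h2 h3.
exists (25^-1 * (alpha%:num * 3 `^ (- (1 + alpha%:num))) * (pi^-1 * (hi - lo))).
  by rewrite !mulr_gt0// ?powR_gt0// ?invr_gt0 ?pi_gt0// subr_gt0.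
move=> L a L0; have [m mE mL] := radius_measure_bounds alpha L0.
have lint (x : R) : lebesgue_measure
   (`[x - L / 10, x + L / 10]%classic : set (measurableTypeR R)) = (L / 5)%:E.
  by rewrite lebesgue_measure_itv /= lte_fin ifT -?EFinB; [congr EFin; field|lra].
exists ((L / 5) * (L / 5) * m * (pi^-1 * (hi - lo))).
  rewrite /stick_measure /stick_box /=.
  rewrite product_measure1E//; last by do 2!apply: measurableX => //.
  rewrite /= product_measure1E//; last by apply: measurableX.
  by rewrite /= product_measure1E// mE angle_measure_itv// !EFinM;
    congr (_ * _ * _ * _)%E; exact: lint.
have LL : L `^ (2 - alpha%:num) = L * L * L `^ (- alpha%:num).
  rewrite powRD; last by rewrite (gt_eqF L0) implybT.
  by rewrite powR_mulrn ?(ltW L0)// expr2.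
move: mL; set C := alpha%:num * _; set k := pi^-1 * _ => mL.
have k0 : 0 <= k by rewrite mulr_ge0// ?invr_ge0 ?pi_ge0// subr_ge0 ltW.
have -> : 25^-1 * C * k * L `^ (2 - alpha%:num) =
    L / 5 * (L / 5) * (C * L `^ (- alpha%:num)) * k by rewrite LL; field.
by rewrite ler_wpM2r// ler_wpM2l// mulr_ge0//; lra.
Qed.

(** With [y = x / k.+1], this is [expR x = (expR y) ^ k.+1 >= y ^ k.+1], inverted. *)
Lemma expRN_le_powX (x : R) (k : nat) : 0 < x -> expR (- x) <= (k.+1%:R / x) ^+ k.+1.
Proof.
move=> x0; rewrite expRN -invf_div exprVn lef_pV2 ?posrE ?expR_gt0//; last first.
  by rewrite exprn_gt0 ?divr_gt0.
have xE : x = (x / k.+1%:R) * k.+1%:R by rewrite divfK.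
rewrite [X in expR X]xE expRM_natr.
rewrite lerXn2r ?nnegrE ?expR_ge0 ?divr_ge0// ?(ltW x0)//.
by rewrite (le_trans _ (expR_ge1Dx _))// lerDr.
Qed.

(** Once [q ^ k.+1 >= 2 * B], the polynomial bound of order [k.+1] on the exponential beats the
    growth of [B ^ n] by a factor [2 ^ n]. *)
Lemma expRN_geometric_decay (c q B : R) : 0 < c -> 1 < q -> 0 <= B ->
  exists2 K, 0 <= K & forall n, B ^+ n * expR (- (c * q ^+ n)) <= K / 2 ^+ n.
Proof.
move=> c0 q1 B0; have q0 : 0 < q by exact: lt_trans q1.
have [k Bk] : exists k, 2 * B <= q ^+ k.+1.
  have lnq : 0 < ln q by rewrite ln_gt0.
  (* This [k] works since [q ^ k.+1 = expR (k.+1 * ln q) >= 1 + k.+1 * ln q]. *)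
  exists (Num.truncn (2 * B / ln q)); set k := (Num.truncn _).+1.
  rewrite -[q]lnK ?posrE// -expRM_natr (le_trans _ (expR_ge1Dx _))//.
  rewrite ler_wpDl// [ln _ * _]mulrC -ler_pdivrMr// ltW//.
  exact: truncnS_gt.
exists ((k.+1%:R / c) ^+ k.+1) => [|n]; first by rewrite exprn_ge0// divr_ge0// ltW.
have qn0 : 0 < q ^+ n by rewrite exprn_gt0.
apply: (@le_trans _ _ (B ^+ n * (k.+1%:R / (c * q ^+ n)) ^+ k.+1)).
  by rewrite ler_wpM2l ?exprn_ge0// expRN_le_powX// mulr_gt0.
rewrite invfM mulrA exprMn mulrCA ler_wpM2l//.
  by rewrite exprn_ge0// divr_ge0// ltW.
rewrite exprVn exprAC ler_pdivrMr ?exprn_gt0// ler_pdivlMl ?exprn_gt0//.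
by rewrite -exprMn lerXn2r ?nnegrE ?mulr_ge0 ?exprn_ge0// ltW.
Qed.

Lemma point_count_neq0 (T : choiceType) (X A : set T) :
  point_count X A <> 0%:R%:E :> \bar R -> exists2 s, X s & A s.
Proof.
move=> XA; have /set0P[s [Xs As]] : X `&` A != set0.
  by apply/eqP => XA0; apply: XA; rewrite /point_count XA0 /counting asboolT// fset_set0.
by exists s.
Qed.

Lemma stick_box_void d (Omega : measurableType d) (P : probability Omega R)
    (u alpha : {posnum R}) (xi : Omega -> set (stickT R)) (lo hi : R) :
  stick_soup P u alpha xi ->
  - (pi / 2) < lo -> lo < hi -> hi <= pi / 2 ->
  exists2 c : R, 0 < c & forall L a, 0 < L ->
    let V := [set w | point_count (xi w) (stick_box L a lo hi) = 0%:R%:E :> \bar R] in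
    measurable V /\ (P V <= (expR (- (c * L `^ (2 - alpha%:num))))%:E)%E.
Proof.
move=> hxi h1 h2 h3; have [c c0 hc] := stick_box_measure alpha h1 h2 h3.
exists (u%:num * c); first by rewrite mulr_gt0.
move=> L a L0 V; have [m mE mL] := hc L a L0; split.
  rewrite -[V]setTI.
  exact: (ppp_measurable hxi (measurable_stick_box L a lo hi) measurableT
    (@emeasurable_set1 _ _)).
rewrite (ppp_poisson hxi (measurable_stick_box L a lo hi)) /= /mscale /= mE ?ltry//=.
by rewrite lee_fin expr0 fact0 mulr1 divr1 ler_expR lerN2 -mulrA ler_wpM2l.
Qed.

(** Natural indices shifted by [N]: those from 0 to [2 * N] give a square grid centred at the
    origin, which has indices [(N, N)]. *)
Definition grid_point (L : R) (N i j : nat) : R * R :=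
  (L * (i%:R - N%:R), L * (j%:R - N%:R)).

(** The factor [4 ^ n] makes the box of side of order [rho ^ n * 4 ^ n] exhaust the plane even for
    [rho = 1/2]; the extra factor 16 is slack for the geometric comparisons. *)
Definition grid_radius n := (4 ^ n.+2)%N.

(** Union bound and Borel-Cantelli: scale [n] has of order [16 ^ n] grid points, each with an empty
    box with probability at most [expR (- (c * q ^ n))], where [q > 1]. *)
Lemma soup_fills_grids d (Omega : measurableType d) (P : probability Omega R)
    (u alpha : {posnum R}) (xi : Omega -> set (stickT R)) (lo hi rho : R) :
  stick_soup P u alpha xi ->
  - (pi / 2) < lo -> lo < hi -> hi <= pi / 2 ->
  0 < rho -> 1 < rho `^ (2 - alpha%:num) ->
  P.-negligible (~` [set w | \forall n \near \oo, forall i j,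
    (i <= 2 * grid_radius n)%N -> (j <= 2 * grid_radius n)%N ->
    exists2 s, xi w s &
      stick_box (rho ^+ n) (grid_point (rho ^+ n) (grid_radius n) i j) lo hi s]).
Proof.
move=> hxi h1 h2 h3 rho0 q1; have [c c0 hc] := stick_box_void hxi h1 h2 h3.
set q := _ `^ _ in q1; have [K K0 hK] := expRN_geometric_decay c0 q1 (ler0n R 16).
pose M n := (2 * grid_radius n).+1.
pose V n i j := [set w | point_count (xi w) (stick_box (rho ^+ n)
   (grid_point (rho ^+ n) (grid_radius n) i j) lo hi) = 0%:R%:E :> \bar R].
pose bad n := \big[setU/set0]_(i < M n) \big[setU/set0]_(j < M n) V n i j.
have mV n i j : measurable (V n i j) by have [] := hc (rho ^+ n)
  (grid_point (rho ^+ n) (grid_radius n) i j) (exprn_gt0 _ rho0).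
have mrow n i : measurable (\big[setU/set0]_(j < M n) V n i j).
  exact: bigsetU_measurable.
have mbad n : measurable (bad n) by exact: bigsetU_measurable.
have PV n i j : (P (V n i j) <= (expR (- (c * q ^+ n)))%:E)%E.
  have [_] := hc (rho ^+ n) (grid_point (rho ^+ n) (grid_radius n) i j) (exprn_gt0 _ rho0).
  suff -> : (rho ^+ n) `^ (2 - alpha%:num) = q ^+ n by [].
  rewrite -(powR_mulrn _ (ltW rho0)) -powRrM mulrC powRrM powR_mulrn//.
  exact: le_trans ler01 (ltW q1).
have [D MD] : exists D, forall n, (M n * M n <= D * 16 ^ n)%N.
  exists (48 * 48)%N => n.
  have a0 : (0 < 4 ^ n)%N by rewrite expn_gt0.
  have Mn : (M n <= 48 * 4 ^ n)%N by rewrite /M /grid_radius !expnS; lia.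
  by rewrite (leq_trans (leq_mul Mn Mn))// mulnACA (expnMn 4 4 n).
(* This is [D * K / 2 ^ n], put in the form [eps / 2 ^ n.+1] that [epsilon_trick] sums. *)
have Pbad n : (P (bad n) <= ((D%:R * K *+ 2) / (2 ^ n.+1)%:R)%:E)%E.
  apply: (@le_trans _ _ (((M n * M n)%:R * expR (- (c * q ^+ n)))%:E)).
    have := @Boole_inequality _ _ _ P (fun i => \big[setU/set0]_(j < M n) V n i j) (M n).
    move=> /(_ (fun i _ => mrow n i)) /le_trans; apply.
    apply: (@le_trans _ _ (\sum_(i < M n) (\sum_(j < M n) (expR (- (c * q ^+ n)))%:E))%E).
      apply: lee_sum => i _; have := @Boole_inequality _ _ _ P (V n i) (M n).
      move=> /(_ (fun j _ => mV n i j)) /le_trans; apply.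
      by apply: lee_sum => j _; exact: PV.
    by rewrite !sumEFin lee_fin !sumr_const !card_ord natrM -mulrA !mulr_natl.
  rewrite lee_fin; apply: (@le_trans _ _ (D%:R * (16 ^+ n * expR (- (c * q ^+ n))))).
    by rewrite mulrA ler_wpM2r ?expR_ge0// -natrX -natrM ler_nat.
  rewrite natrX exprS -mulrnAr -[K *+ 2]mulr_natl invfM.
  have -> : D%:R * (2 * K) * (2^-1 / 2 ^+ n) = D%:R * (K / 2 ^+ n) :> R by field.
  by rewrite ler_wpM2l.
have bad0 : P (lim_sup_set bad) = 0%E.
  apply: lim_sup_set_cvg0 => //.
  apply: (@le_lt_trans _ _ (\sum_(0 <= n <oo) (0 + ((D%:R * K *+ 2) / (2 ^ n.+1)%:R)%:E))%E).
    by apply: lee_nneseries => // n _; rewrite add0e; exact: Pbad.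
  apply: le_lt_trans (epsilon_trick xpredT _ _) _ => //.
    by rewrite mulrn_wge0// mulr_ge0.
  by rewrite eseries0 ?add0e ?ltry.
have mlim : measurable (lim_sup_set bad).
  by apply: bigcap_measurable => // k _; exact: bigcup_measurable.
apply: negligibleS (_ : P.-negligible (lim_sup_set bad)); last exact/negligibleP.
move=> w /= Hw n _; apply: contrapT => nbad; apply: Hw.
exists n => // m /= nm i j iM jM; apply: point_count_neq0 => Vw.
apply: nbad; exists m => //.
rewrite /bad -(bigcup_mkord _ (fun i => \big[setU/set0]_(j < M m) V m i j)).
exists i => /=; first by rewrite /M ltnS.
by rewrite -bigcup_mkord; exists j => //=; rewrite /M ltnS.
Qed.

(** * Grids of sticks *)

(** Rounding to the nearest integer. The margin 1 in the hypothesis keeps [i] off the ends 0 and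
    [2 * N], so both neighbouring indices remain in the grid. *)
Lemma truncn_round (x : R) (N : nat) : `|x| <= N%:R - 1 ->
  exists i, (1 <= i)%N /\ (i <= 2 * N - 1)%N /\ `|x - (i%:R - N%:R)| <= 1 / 2.
Proof.
rewrite ler_norml => /andP[x1 x2].
pose y := x + N%:R + 1 / 2; exists (Num.truncn y).
have y0 : 0 <= y by rewrite /y; lra.
have /andP[t1 t2] := truncn_itv y0.
have N1 : (1 <= N)%N by rewrite -(ler_nat R); lra.
split; first by rewrite -ltnS -(ltr_nat R); apply: le_lt_trans t2; rewrite /y; lra.
split.
  rewrite -ltnS subn1 prednK; last by lia.
  by rewrite -(ltr_nat R); apply: le_lt_trans t1 _; rewrite natrM /y; lra.
have k1 : (Num.truncn y).+1%:R = (Num.truncn y)%:R + 1 :> R by rewrite natr1.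
move: (Num.truncn y) k1 t1 t2 => k -> t1 t2; rewrite /y in t1 t2.
by rewrite ler_norml; apply/andP; split; lra.
Qed.

Lemma grid_cover L N p : 0 < L ->
  `|p.1| <= L * (N%:R - 1) -> `|p.2| <= L * (N%:R - 1) ->
  exists i j, [/\ (1 <= i <= 2 * N - 1)%N, (1 <= j <= 2 * N - 1)%N &
    inbox (L / 2) (grid_point L N i j) p].
Proof.
move=> L0 p1 p2.
have scale (x y : R) : `|x / L - y| <= 1 / 2 -> `|x - L * y| <= L / 2.
  move=> h; have -> : x - L * y = L * (x / L - y) by field; rewrite gt_eqF.
  by rewrite normrM gtr0_norm// ler_pM2l//; lra.
have /truncn_round[i [i1 [i2 ip]]] : `|p.1 / L| <= N%:R - 1.
  by rewrite normrM normfV (gtr0_norm L0) ler_pdivrMr// mulrC.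
have /truncn_round[j [j1 [j2 jp]]] : `|p.2 / L| <= N%:R - 1.
  by rewrite normrM normfV (gtr0_norm L0) ler_pdivrMr// mulrC.
by exists i, j; split; rewrite ?i1 ?j1//; split; exact: scale.
Qed.

Definition fills (X : set (stickT R)) L N := forall i j,
  (i <= 2 * N)%N -> (j <= 2 * N)%N ->
  (exists2 s, X s & hstick L (grid_point L N i j) s) /\
  (exists2 s, X s & vstick L (grid_point L N i j) s).

(** The grid point nearest to [p] is interior. Horizontal sticks at its upper and lower neighbours
    and vertical ones at its right and left neighbours form the frame. *)
Lemma fills_traps X L N (C : set (R * R)) p : 0 < L -> fills X L N ->
  connected C -> (forall s, X s -> C `&` stick s = set0) ->
  C p -> `|p.1| <= L * (N%:R - 1) -> `|p.2| <= L * (N%:R - 1) ->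
  exists a, C `<=` inbox (3/2 * L) a.
Proof.
move=> L0 fX cC CX Cp p1 p2.
have [i [j [/andP[i1 i2] /andP[j1 j2] ip]]] := grid_cover L0 p1 p2.
set a := grid_point L N i j in ip; exists a.
have [iN jN] : (i <= 2 * N)%N /\ (j <= 2 * N)%N by lia.
have [iS jS] : (i.+1 <= 2 * N)%N /\ (j.+1 <= 2 * N)%N by lia.
have [iP jP] : (i.-1 <= 2 * N)%N /\ (j.-1 <= 2 * N)%N by lia.
have [sT XT hT] : exists2 s, X s & hstick L (a.1, a.2 + L) s.
  have [s Xs hs] := (fX _ _ iN jS).1.
  exists s => //; move: hs; congr (hstick _ _ _).
  by congr pair; rewrite /= -natr1; ring.
have [sB XB hB] : exists2 s, X s & hstick L (a.1, a.2 - L) s.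
  have [s Xs hs] := (fX _ _ iN jP).1.
  exists s => //; move: hs; congr (hstick _ _ _).
  by congr pair; rewrite /= -{2}(prednK j1) -natr1; ring.
have [sR XR vR] : exists2 s, X s & vstick L (a.1 + L, a.2) s.
  have [s Xs hs] := (fX _ _ iS jN).2.
  exists s => //; move: hs; congr (vstick _ _ _).
  by congr pair; rewrite /= -natr1; ring.
have [sL XL vL] : exists2 s, X s & vstick L (a.1 - L, a.2) s.
  have [s Xs hs] := (fX _ _ iP jN).2.
  exists s => //; move: hs; congr (vstick _ _ _).
  by congr pair; rewrite /= -{2}(prednK i1) -natr1; ring.
apply: (frame_traps L0 hT hB vR vL cC _ Cp ip) => q Cq.
by split=> sq; [have := CX _ XT|have := CX _ XB|have := CX _ XR|have := CX _ XL];
  move/seteqP => -[/(_ q)] /= h _; apply: h.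
Qed.

Lemma component_absorbs (E B : set (R * R)) x : connected B -> B `<=` E ->
  connected_component E x `&` B !=set0 -> B `<=` connected_component E x.
Proof.
move=> cB BE [y [Cy By]] z Bz; apply: (connected_component_trans Cy).
by exists B.
Qed.

(** Membership in the component spreads along the grid: the horizontal stick at a grid point crosses
    the vertical sticks there and at every adjacent point. *)
Lemma fills_component X L N x i j i' j' s t : 0 < L -> fills X L N ->
  (i <= 2 * N)%N -> (j <= 2 * N)%N -> (i' <= 2 * N)%N -> (j' <= 2 * N)%N ->
  X s -> hstick L (grid_point L N i j) s \/ vstick L (grid_point L N i j) s ->
  connected_component (covered_set X) x `&` stick s !=set0 ->
  X t -> vstick L (grid_point L N i' j') t ->
  stick t `<=` connected_component (covered_set X) x.
Proof.
move=> L0 fX iN jN iN' jN' Xs hvs Cs Xt vt.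
set C := connected_component _ _ in Cs *.
have L0' := ltW L0.
have sub r : X r -> C `&` stick r !=set0 -> stick r `<=` C.
  move=> Xr; apply: component_absorbs; first exact: stick_connected.
  by move=> y ry; exists r.
have sub2 r r' : X r' -> stick r `<=` C ->
    stick r `&` stick r' !=set0 -> stick r' `<=` C.
  by move=> Xr' rC [y [ry ry']]; apply: sub => //; exists y; split => //; exact: rC.
have sub2' r r' : X r' -> stick r `<=` C ->
    stick r' `&` stick r !=set0 -> stick r' `<=` C.
  by move=> Xr' rC; rewrite setIC; exact: sub2.
have near0 (k l : nat) : (k <= l.+1)%N -> (l <= k.+1)%N ->
    `|L * (k%:R - N%:R) - L * (l%:R - N%:R)| <= L.
  move=> kl lk; have -> : L * (k%:R - N%:R) - L * (l%:R - N%:R) = L * (k%:R - l%:R) by ring.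
  rewrite normrM gtr0_norm// ger_pMr// ler_norml.
  by move: kl lk; rewrite -!(ler_nat R) -!natr1 => ? ?; apply/andP; split; lra.
pose P k l := forall r, X r -> vstick L (grid_point L N k l) r -> stick r `<=` C.
have step k l k' l' : (k <= 2 * N)%N -> (l <= 2 * N)%N ->
    (k <= k'.+1)%N -> (k' <= k.+1)%N -> (l <= l'.+1)%N -> (l' <= l.+1)%N ->
    P k l -> P k' l'.
  move=> kN lN kk kk' ll ll' Pkl r Xr vr.
  have [[h Xh hh] [v Xv vv]] := fX k l kN lN.
  have hC : stick h `<=` C.
    apply: (sub2' v) => //; first exact: Pkl.
    by apply: (sticks_cross L0' hh vv); rewrite /= subrr normr0.
  by apply: (sub2 h) => //; apply: (sticks_cross L0' hh vr); exact: near0.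
have Pij : P i j.
  have sC := sub s Xs Cs.
  move=> r Xr vr.
  have [[h Xh hh] _] := fX i j iN jN.
  have hC : stick h `<=` C.
    case: hvs => [hs|vs]; last first.
      apply: (sub2' s) => //.
      by apply: (sticks_cross L0' hh vs); rewrite /= subrr normr0.
    apply: (sub2' r) => //; last first.
      by apply: (sticks_cross L0' hh vr); rewrite /= subrr normr0.
    apply: (sub2 s) => //.
    by apply: (sticks_cross L0' hs vr); rewrite /= subrr normr0.
  by apply: (sub2 h) => //; apply: (sticks_cross L0' hh vr); rewrite /= subrr normr0.
(* The walk goes from [(i, j)] through [(0, j)], [(0, 0)] and [(i', 0)] to [(i', j')]. *)
have P0j : P 0%N j.
  elim: i iN Pij {hvs} => // k IH kN Pk; apply: IH; first lia.
  by apply: step Pk; lia.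
have P00 : P 0%N 0%N.
  elim: j jN P0j {Pij hvs} => // k IH kN Pk; apply: IH; first lia.
  by apply: step Pk; lia.
have Pi0 : P i' 0%N.
  elim: i' iN' {vt} => // k IH kN; apply: step (IH _); lia.
have Pij' : P i' j'.
  elim: j' jN' {vt} => // k IH kN; apply: step (IH _); lia.
exact: Pij'.
Qed.

Lemma inbox_bounded r a (C : set (R * R)) : C `<=` inbox r a -> bounded_set C.
Proof.
move=> Cr; exists (r + `|a.1| + `|a.2|); split; first exact: num_real.
move=> M rM q /Cr[q1 q2]; rewrite /= prod_normE /= ge_max.
have := ler_normD (q.1 - a.1) a.1; have := ler_normD (q.2 - a.2) a.2.
have := normr_ge0 a.1; have := normr_ge0 a.2; rewrite !subrK => ? ? ? ?.
by apply/andP; split; lra.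
Qed.

Lemma bounded_set_fst (C : set (R * R)) : bounded_set C ->
  exists M, forall q, C q -> `|q.1| <= M.
Proof.
move=> [M [_ CM]]; exists (M + 1) => q Cq.
apply: le_trans (CM (M + 1) _ q Cq); last by rewrite ltrDl.
by rewrite /= prod_normE le_max lexx.
Qed.

(** Used with [e = 2 - alpha]: large sticks are the dense ones for [alpha < 2], small ones for
    [alpha > 2]. The range of [rho] makes consecutive scales comparable up to a factor 2. *)
Lemma exists_dense_scale (e : R) : e != 0 ->
  exists2 rho : R, 1 / 2 <= rho <= 2 & 1 < rho `^ e.
Proof.
rewrite neq_lt => /orP[e0|e0]; [exists (1 / 2)|exists 2]; try by apply/andP; split; lra.
  rewrite /powR gt_eqF; last lra.
  by rewrite expR_gt1 nmulr_rgt0// ln_lt0//; apply/andP; split; lra.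
by rewrite /powR gt_eqF// expR_gt1 mulr_gt0// ln_gt0// ltr1n.
Qed.

Lemma stick_box_near_center L a lo hi s :
  stick_box L a lo hi s -> near_center L a s /\ lo <= s.2 <= hi.
Proof.
case: s => [[[x y] r] v]; rewrite /stick_box /near_center /= !in_itv /=.
move=> [[[/andP[? ?] /andP[? ?]] /andP[? ?]] ->]; split=> //.
by split=> //; rewrite ler_norml; apply/andP; split; lra.
Qed.

End sticks.

(** * Deterministic consequences of grids filled at all large scales *)

Section dense_grids.
Context {R : realType}.
Context (rho : R) (X : set (stickT R)) (rho2 : 1 / 2 <= rho <= 2)
  (fX : \forall n \near \oo, fills X (rho ^+ n) (grid_radius n)).

Let rho0 : 0 < rho. Proof. by move/andP: rho2 => [? _]; lra. Qed.

Let L0 n : 0 < rho ^+ n. Proof. exact: exprn_gt0. Qed.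

(** From [4 * rho >= 2] and [4 ^ n >= 1]: the box outgrows every bounded set, and it is also large
    compared with its own mesh. *)
Lemma grid_radius_large n :
  16 * 2 ^+ n <= rho ^+ n * (grid_radius n)%:R /\
  16 * rho ^+ n <= rho ^+ n * (grid_radius n)%:R.
Proof.
have -> : (grid_radius n)%:R = 16 * 4 ^+ n :> R.
  by rewrite /grid_radius !expnS mulnA natrM natrX.
have h : 2 ^+ n <= rho ^+ n * 4 ^+ n.
  rewrite -exprMn lerXn2r ?nnegrE//; first by rewrite mulr_ge0// ltW.
  by move/andP: rho2 => [? _]; lra.
have h' : rho ^+ n <= rho ^+ n * 4 ^+ n.
  by rewrite ler_peMr ?(ltW (L0 n))// exprn_ege1// ler1n.
by split; lra.
Qed.

Lemma exceeds_pow2 (M : R) n : (Num.truncn M < n)%N -> M < 2 ^+ n.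
Proof.
move=> Mn; apply: (lt_trans (truncnS_gt M)); apply: (@le_lt_trans _ _ n%:R).
  by rewrite ler_nat.
by rewrite -natrX ltr_nat ltn_expl.
Qed.

Lemma vacant_not_percolates : ~ percolates (vacant_set X).
Proof.
case: fX => n0 _ fX0 [x Vx]; apply; set C := connected_component _ x.
(* At this scale [2 ^ n] exceeds both coordinates of [x], which puts [x] in the part of the grid box
   where [fills_traps] applies. *)
pose n := (maxn n0 (maxn (Num.truncn `|x.1|).+1 (Num.truncn `|x.2|).+1)).
have [n0n n1 n2] : [/\ (n0 <= n)%N, (Num.truncn `|x.1| < n)%N & (Num.truncn `|x.2| < n)%N].
  by rewrite /n; split; lia.
have [S1 S2] := grid_radius_large n.
have := exceeds_pow2 n1; have := exceeds_pow2 n2.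
have := L0 n => Ln x2 x1.
have [a Ca] : exists a, C `<=` inbox (3/2 * rho ^+ n) a.
  apply: (fills_traps (L0 n) (fX0 n n0n) (p := x)).
  - exact: component_connected.
  - move=> s Xs; rewrite -subset0 => y [/connected_component_sub Vy sy].
    by apply: Vy; exists s.
  - exact: connected_component_refl.
  - by rewrite mulrBr mulr1; lra.
  - by rewrite mulrBr mulr1; lra.
exact: inbox_bounded Ca.
Qed.

(** Induction over the scales: every vertical grid stick of scale [n] lies in the component [C] of
    one fixed stick centre, and these sticks reach arbitrarily far. *)
Lemma covered_percolates : percolates (covered_set X).
Proof.
case: fX => n0 _ fX0; pose N n := grid_radius n.
have fill n : (n0 <= n)%N -> fills X (rho ^+ n) (N n) by exact: fX0.
have [_ [s0 Xs0 vs0]] := fill n0 (leqnn _) 0%N 0%N isT isT.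
have center (n : nat) a s : vstick (rho ^+ n) a s -> stick s s.1.1.
  case=> -[_ _ sL] _; apply: stick_center; apply: le_trans sL.
  by rewrite mulr_ge0// ltW.
pose x0 := s0.1.1; set C := connected_component (covered_set X) x0.
have Ex0 : covered_set X x0 by exists s0 => //; exact: center vs0.
pose P n := forall i j t, (i <= 2 * N n)%N -> (j <= 2 * N n)%N ->
  X t -> vstick (rho ^+ n) (grid_point (rho ^+ n) (N n) i j) t -> stick t `<=` C.
have P0 : P n0.
  move=> i j t iN jN Xt vt.
  apply: (fills_component (L0 n0) (fill _ (leqnn _)) (leq0n _) (leq0n _) iN jN Xs0) => //.
    by right; exact: vs0.
  exists x0; split; first exact: connected_component_refl.
  exact: center vs0.
have PS n : (n0 <= n)%N -> P n -> P n.+1.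
  move=> n0n Pn; have n0n1 : (n0 <= n.+1)%N by exact: leqW.
  (* Only sticks attached to grid points of scale [n.+1] are kept: if [C] hits one of them,
     [fills_component] spreads from its grid point; if it hits none, they still fill the grid and
     trap [C]. *)
  pose X' := [set s | X s /\ exists i j, [/\ (i <= 2 * N n.+1)%N, (j <= 2 * N n.+1)%N &
    hstick (rho ^+ n.+1) (grid_point (rho ^+ n.+1) (N n.+1) i j) s \/
    vstick (rho ^+ n.+1) (grid_point (rho ^+ n.+1) (N n.+1) i j) s]].
  have fX' : fills X' (rho ^+ n.+1) (N n.+1).
    move=> i j iN jN; have [[h Xh hh] [v Xv vv]] := fill _ n0n1 i j iN jN.
    by split; [exists h|exists v] => //; split => //; exists i, j; split => //;
      [left|right].
  have [[s [Xs [i [j [iN jN hvs]]]] Cs]|noX] :=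
      pselect (exists2 s, X' s & C `&` stick s !=set0).
    move=> i' j' t iN' jN' Xt vt.
    exact: (fills_component (L0 n.+1) (fill _ n0n1) iN jN iN' jN' Xs hvs Cs).
  (* Otherwise [C] would fit in a frame of scale [n.+1], yet it contains two
     stick centres of scale [n] that are too far apart. *)
  exfalso.
  have [N1 N2] : (N n <= 2 * N n)%N /\ (0 <= 2 * N n)%N by lia.
  have [_ [z Xz vz]] := fill n n0n (N n) (N n) N1 N1.
  have [_ [z' Xz' vz']] := fill n n0n 0%N 0%N N2 N2.
  have Cz : C z.1.1 by apply: (Pn _ _ _ N1 N1 Xz vz); exact: center vz.
  have Cz' : C z'.1.1 by apply: (Pn _ _ _ N2 N2 Xz' vz'); exact: center vz'.
  have [[z1 z2 _] _] := vz; have [[z1' _ _] _] := vz'.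
  have [S1 S2] := grid_radius_large n; have [S3 S4] := grid_radius_large n.+1.
  have [Ln Ln1] : rho ^+ n.+1 <= 2 * rho ^+ n /\ rho ^+ n <= 2 * rho ^+ n.+1.
    move/andP: rho2 => [? ?]; rewrite exprS mulrA; split; first by rewrite ler_pM2r.
    by rewrite ler_peMl ?(ltW (L0 n))//; lra.
  have L0n := L0 n; have L0n1 := L0 n.+1.
  have [a Ca] : exists a, C `<=` inbox (3/2 * rho ^+ n.+1) a.
    apply: (fills_traps L0n1 fX' (p := z.1.1)) => //.
    - exact: component_connected.
    - move=> s Xs; apply: contrapT => Cs; apply: noX; exists s => //.
      by apply/set0P/eqP.
    - move: z1; rewrite /= subrr mulr0 subr0 => /le_trans; apply.
      by rewrite mulrBr mulr1 -/(N n.+1) /N; lra.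
    - move: z2; rewrite /= subrr mulr0 subr0 => /le_trans; apply.
      by rewrite mulrBr mulr1 /N; lra.
  (* The centres are near the origin and near the grid corner, so their abscissas differ by at least
     [16 * rho ^ n - rho ^ n / 5]; the trapping box has width [3 * rho ^ n.+1 <= 6 * rho ^ n]. *)
  have [c1 _] := Ca _ Cz; have [c1' _] := Ca _ Cz'.
  move: z1 z1' c1 c1'; rewrite /= subrr sub0r mulr0 subr0 mulrN opprK /N !ler_norml.
  by move=> /andP[? ?] /andP[? ?] /andP[? ?] /andP[? ?]; lra.
have Pall n : (n0 <= n)%N -> P n.
  elim: n => [|n IH]; first by rewrite leqn0 => /eqP n00; rewrite -n00.
  by rewrite leq_eqVlt => /orP[/eqP <- //|]; rewrite ltnS => n0n; apply: PS (IH _).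
exists x0 => // /bounded_set_fst[M CM].
pose n := maxn n0 (Num.truncn M).+1.
have [n0n n1] : (n0 <= n)%N /\ (Num.truncn M < n)%N by rewrite /n; split; lia.
(* The corner stick has its centre at abscissa about [- rho ^ n * N n], beyond [M] in absolute
   value. *)
have [_ [z Xz vz]] := fill n n0n 0%N 0%N (leq0n _) (leq0n _).
have Cz : C z.1.1.
  by apply: (Pall n n0n _ _ _ (leq0n _) (leq0n _) Xz vz); exact: center vz.
have [[z1 _ _] _] := vz; have [S1 S2] := grid_radius_large n.
have Mn := exceeds_pow2 n1; have Ln := L0 n.
have p0 : 0 < 2 ^+ n :> R by rewrite exprn_gt0.
move: z1 (CM _ Cz); rewrite /= sub0r mulrN opprK /N !ler_norml.
by move=> /andP[? ?] /andP[? ?]; lra.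
Qed.

End dense_grids.

(** * Almost sure transfer to the Poisson stick soup *)

Theorem proposition3p1 (R : realType) (d : measure_display)
    (Omega : measurableType d) (P : probability Omega R)
    (u alpha : {posnum R}) (xi : Omega -> set (stickT R))
    (alpha_neq2 : alpha%:num != 2)
    (xi_hps : stick_soup P u alpha xi) :
  {ae P, forall w, percolates (covered_set (xi w))} /\
  P.-negligible [set w | percolates (vacant_set (xi w))].
Proof.
have [rho rho2 rho1] := @exists_dense_scale R (2 - alpha%:num)
  ltac:(by rewrite subr_eq0 eq_sym).
have rho0 : 0 < rho by move/andP: rho2 => [? _]; lra.
have pi0 := pi_gt0 R; have [dl /andP[dl0 dlpi] fdl] := @flat_near0 R.
have fillH := @soup_fills_grids _ _ _ P _ _ _ 0 dl _ xi_hps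
  ltac:(lra) dl0 (ltW dlpi) rho0 rho1.
(* The reflection [v -> pi / 2 - v] maps this interval to [[0, dl]], so its angles are steep by
   [flat_steep]. *)
have fillV := @soup_fills_grids _ _ _ P _ _ _ (pi / 2 - dl) (pi / 2) _ xi_hps
  ltac:(lra) ltac:(lra) (lexx _) rho0 rho1.
have fillN : P.-negligible (~` [set w | \forall n \near \oo,
    fills (xi w) (rho ^+ n) (grid_radius n)]).
  apply: negligibleS (negligibleU fillH fillV) => w /= nfill.
  apply: contrapT => /not_orP[/contrapT Hw /contrapT Vw]; apply: nfill.
  near=> n => i j iN jN.
  have [h Xh /stick_box_near_center[hc hv]] :
    exists2 s, xi w s & stick_box (rho ^+ n)
      (grid_point (rho ^+ n) (grid_radius n) i j) 0 dl s.
    by move: i j iN jN; near: n; exact: Hw.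
  have [v Xv /stick_box_near_center[vc vv]] :
    exists2 s, xi w s & stick_box (rho ^+ n)
      (grid_point (rho ^+ n) (grid_radius n) i j) (pi / 2 - dl) (pi / 2) s.
    by move: i j iN jN {h Xh hc hv}; near: n; exact: Vw.
  split; [exists h|exists v] => //; split=> //; first exact: fdl.
  have -> : v.2 = pi / 2 - (pi / 2 - v.2) by rewrite subKr.
  by apply: flat_steep; apply: fdl; move/andP: vv => [? ?]; apply/andP; split; lra.
(* Both exceptional sets lie in the single negligible set where the grids fail to be filled at all
   large scales. *)
split; apply: negligibleS fillN => w /= Hw fw.
  by apply: Hw; exact: covered_percolates rho2 fw.
exact: (vacant_not_percolates rho2 fw Hw).
Unshelve. all: by end_near.
Qed.
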